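(* Let $k\ge a\ge 1$ be integers. For $n\ge 0$ let $Q_{k,a}(n)$ denote the number of lattice paths that satisfy the special $(k,a)$-conditions, have major index $n$, and all of whose peaks have odd weight. For integers $N_1\ge N_2\ge\cdots\ge N_{k-1}\ge 0$ put $n_i=N_i-N_{i+1}$ for $1\le i\le k-1$, where $N_j=0$ for $j\ge k$, and use the convention $N_0:=N_1$. If $a$ is odd, then \[\sum_{n\ge 0}Q_{k,a}(n)q^n=\sum_{N_1\ge N_2\ge\cdots\ge N_{k-1}\ge 0}\frac{q^{N_1^2+N_2^2+\cdots+N_{k-1}^2+n_2+n_4+\cdots+n_{a-3}+N_{a-1}+N_a+N_{a+1}+\cdots+N_{k-1}}}{(q^2;q^2)_{N_1-N_2}\cdots(q^2;q^2)_{N_{k-2}-N_{k-1}}(q^2;q^2)_{N_{k-1}}}.\] If $a$ is even, then \[\sum_{n\ge 0}Q_{k,a}(n)q^n=\sum_{N_1\ge N_2\ge\cdots\ge N_{k-1}\ge 0}\frac{q^{N_1^2+N_2^2+\cdots+N_{k-1}^2+n_2+n_4+\cdots+n_{a-2}+N_a+N_{a+1}+\cdots+N_{k-1}}}{(q^2;q^2)_{N_1-N_2}\cdots(q^2;q^2)_{N_{k-2}-N_{k-1}}(q^2;q^2)_{N_{k-1}}}.\] Here $n_2+n_4+\cdots+n_{a-3}$ (respectively $n_2+n_4+\cdots+n_{a-2}$) is the sum of $n_i$ over even $i$ with $2\le i\le a-3$ (respectively $2\le i\le a-2$), and is $0$ if there is no such $i$; likewise $N_a+N_{a+1}+\cdots+N_{k-1}$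 is $0$ if $a=k$.
   Context: Lattice paths: a lattice path is a path in the first quadrant ($x,y\ge 0$, integer vertices) that starts on the $y$-axis (at $x=0$), ends on the $x$-axis, and uses unit steps of three kinds: North-East $(x,y)\to(x+1,y+1)$; South-East $(x,y)\to(x+1,y-1)$; East $(x,0)\to(x+1,0)$, which is allowed only at height $0$. A path is either empty or ends with a South-East step. The height of a vertex $(x,y)$ is $y$ and its weight is $x$. A peak is a vertex preceded by a North-East step and followed by a South-East step. The major index of a path is the sum of the weights of its peaks. A path satisfies the special $(k,a)$-conditions if it starts at height $k-a$ and all its vertices have height less than $k$. Notation: $(q^2;q^2)_m=\prod_{i=1}^{m}(1-q^{2i})$. For $k=1$ the multiple sum has no summation variables and is interpreted as a single term equal to $1$. *)

(* Defs.v *)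
From HB Require Import structures.
From mathcomp Require Import all_boot all_order all_algebra.
From mathcomp Require Import finmap zify.
From mathcomp Require Import boolp classical_sets functions cardinality fsbigop.

Set Implicit Arguments.
Unset Strict Implicit.
Unset Printing Implicit Defensive.

Import GRing.Theory.

(* A lattice path is the nonempty sequence of all its vertices (x, y); the
   empty path is the one with a single vertex.  The first quadrant and
   integrality constraints are built into [nat * nat]. *)

Notation vertex := (nat * nat)%type.
Definition weight (v : vertex) : nat := v.1.
Definition height (v : vertex) : nat := v.2.

Definition northeast (u v : vertex) : bool :=
  (v.1 == u.1.+1) && (v.2 == u.2.+1).
Definition southeast (u v : vertex) : bool :=
  (v.1 == u.1.+1) && (u.2 == v.2.+1).
Definition east (u v : vertex) : bool :=
  [&& v.1 == u.1.+1, u.2 == 0 & v.2 == 0].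

Definition lattice_step (u v : vertex) : bool :=
  [|| northeast u v, southeast u v | east u v].

Definition lattice_path (s : seq vertex) : bool :=
  if s is v :: p then
    [&& v.1 == 0, path lattice_step v p, (last v p).2 == 0
      & (p == [::]) || southeast (nth v s (size p).-1) (last v p)]
  else false.

Definition is_peak (s : seq vertex) (i : nat) : bool :=
  [&& 0 < i, i.+1 < size s,
      northeast (nth (0, 0) s i.-1) (nth (0, 0) s i)
    & southeast (nth (0, 0) s i) (nth (0, 0) s i.+1)].

Definition peaks (s : seq vertex) : seq vertex :=
  [seq nth (0, 0) s i | i <- iota 0 (size s) & is_peak s i].

Definition major_index (s : seq vertex) : nat :=
  \sum_(v <- peaks s) weight v.

Definition special_conditions (k a : nat) (s : seq vertex) : bool :=
  (height (head (0, 0) s) == k - a) && all (fun v => height v < k) s.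

Definition Qpaths (k a n : nat) : set (seq vertex) :=
  [set s | [&& lattice_path s, special_conditions k a s, major_index s == n
             & all (fun v => odd (weight v)) (peaks s)]]%classic.

(* [fset_set] is only meaningful on finite sets: see [finite_Qpaths]. *)
Definition Q (k a n : nat) : nat := #|` fset_set (Qpaths k a n) |%fset.

Lemma lattice_path_weight s i :
  lattice_path s -> i < size s -> (nth (0, 0) s i).1 = i.
Proof.
case: s => [//|v p] /and4P[/eqP v0 + _ _].
move=> /(pathP (0, 0)) vp; elim: i => [//|i IHi] lti.
have /esym iE := IHi (ltnW lti); rewrite [in RHS]iE; move: (vp i lti).
change (nth (0, 0) p i) with (nth (0, 0) (v :: p) i.+1).
by rewrite /lattice_step => /or3P[/andP[/eqP]|/andP[/eqP]|/and3P[/eqP]].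
Qed.

Lemma lattice_path_size k a n s : Qpaths k a n s -> size s <= (n + k).+1.
Proof.
move=> /and4P[sP /andP[_ /allP sk] /eqP sn _].
case: (posnP (size s).-1) => [|s0]; first by lia.
have [v [p sE]] : exists v p, s = v :: p by case: s sP {sk sn s0} => [//|v p]; exists v, p.
have wE := lattice_path_weight sP.
have step i : i.+1 < size s -> lattice_step (nth (0, 0) s i) (nth (0, 0) s i.+1).
  move: sP; rewrite sE => /and4P[_ /(pathP (0, 0)) + _ _] lti.
  exact.
have [lastP1 lastP2] : (nth (0, 0) s (size s).-1).2 = 0 /\
    southeast (nth (0, 0) s (size s).-2) (nth (0, 0) s (size s).-1).
  move: sP s0; rewrite sE /= => /and4P[_ _ /eqP l0 lS] p0.
  have lE : nth (0, 0) (v :: p) (size p) = last v p by rewrite (last_nth (0, 0)).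
  rewrite lE l0; split=> //; case/orP: lS => [/eqP p0'|]; first by rewrite p0' in p0.
  by rewrite (set_nth_default (0, 0))//= ltnS leq_pred.
suff : (size s).-1 <= n + k by lia.
have main j : j.+1 < size s ->
    (nth (0, 0) s j).2 + j = (size s).-1 ->
    southeast (nth (0, 0) s j) (nth (0, 0) s j.+1) -> (size s).-1 <= n + k.
  elim: j => [|j IHj] lt_j jE jS.
    rewrite -jE addn0; have /sk : nth (0, 0) s 0 \in s by apply: mem_nth; exact: ltnW.
    rewrite /height; lia.
  case/or3P: (step j (ltnW lt_j)) => jS'.
  - have pk : is_peak s j.+1 by rewrite /is_peak /= lt_j jS' jS.
    have lt1 : j.+1 < size s by lia.
    have : j.+1 <= n.
      rewrite -sn /major_index big_map.
      rewrite (bigD1_seq j.+1) /= ?filter_uniq ?iota_uniq//; last first.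
        by rewrite mem_filter pk mem_iota/= add0n.
      by rewrite /weight wE// leq_addr.
    have /sk : nth (0, 0) s j.+1 \in s by apply: mem_nth.
    rewrite /height; lia.
  - apply: IHj => //; first lia.
    by move: jS' jE => /andP[_ /eqP]; lia.
  - by move: jS' jS => /and3P[_ _ /eqP h0] /andP[_ /eqP]; rewrite h0.
apply: (main (size s).-2); first lia.
  by move: lastP2 => /andP[_ /eqP ->]; rewrite lastP1; lia.
by move: lastP2; rewrite (_ : (size s).-2.+1 = (size s).-1) //; lia.
Qed.

Lemma finite_Qpaths k a n : finite_set (Qpaths k a n).
Proof.
pose m := (n + k).+1.
pose f (t : m.-bseq ('I_m * 'I_k)) : seq vertex :=
  [seq (val u.1, val u.2) | u <- t].
have fin : finite_set (f @` setT)%classic by apply: finite_image; exact: finite_finset.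
apply: sub_finite_set fin => s sQ.
have szs := lattice_path_size sQ.
move: sQ => /and4P[sP /andP[_ /allP sk] _ _].
have sm v : v \in s -> (v.1 < m) && (v.2 < k).
  move=> vs; rewrite (sk v vs) andbT.
  rewrite -(nth_index (0, 0) vs) (lattice_path_weight sP) ?index_mem//.
  by apply: leq_trans szs; rewrite index_mem.
have [t tE] : exists t : seq ('I_m * 'I_k), [seq (val u.1, val u.2) | u <- t] = s.
  elim: s sm {szs sP sk} => [|v s IHs] sm; first by exists [::].
  have [|t <-] := IHs; first by move=> u us; apply: sm; rewrite inE us orbT.
  have /andP[v1 v2] := sm v (mem_head _ _).
  by exists ((Ordinal v1, Ordinal v2) :: t) => /=; case: v v1 v2 {sm}.
have szt : size t <= m by rewrite -(size_map (fun u : 'I_m * 'I_k => (val u.1, val u.2))) tE.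
by exists (Bseq szt).
Qed.

Local Open Scope ring_scope.

(* Formal power series in one variable q, as a commutative unit ring. *)

Record fps (R : Type) := Fps { fcoef : nat -> R }.

Lemma fpsP (R : Type) (f g : fps R) : fcoef f =1 fcoef g -> f = g.
Proof. by case: f g => [f] [g] /= /funext ->. Qed.

HB.instance Definition _ (R : Type) := gen_eqMixin (fps R).
HB.instance Definition _ (R : Type) := gen_choiceMixin (fps R).

Section FpsRing.
Variable R : comUnitRingType.
Implicit Types f g h : fps R.

Definition fps0 : fps R := Fps (fun=> 0).
Definition fps1 : fps R := Fps (fun n => (n == 0%N)%:R).
Definition fpsX : fps R := Fps (fun n => (n == 1%N)%:R).
Definition fpsN f : fps R := Fps (fun n => - fcoef f n).
Definition fpsD f g : fps R := Fps (fun n => fcoef f n + fcoef g n).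
Definition fpsM f g : fps R :=
  Fps (fun n => \sum_(i < n.+1) fcoef f i * fcoef g (n - i)).

Lemma fpsDA : associative fpsD.
Proof. by move=> f g h; apply: fpsP => n /=; rewrite addrA. Qed.
Lemma fpsDC : commutative fpsD.
Proof. by move=> f g; apply: fpsP => n /=; rewrite addrC. Qed.
Lemma fps0D : left_id fps0 fpsD.
Proof. by move=> f; apply: fpsP => n /=; rewrite add0r. Qed.
Lemma fpsND : left_inverse fps0 fpsN fpsD.
Proof. by move=> f; apply: fpsP => n /=; rewrite addNr. Qed.

HB.instance Definition _ := GRing.isZmodule.Build (fps R) fpsDA fpsDC fps0D fpsND.

Lemma fpsM_poly f g m n : (m <= n)%N -> fcoef (fpsM f g) m =
  ((\poly_(i < n.+1) fcoef f i) * (\poly_(i < n.+1) fcoef g i))`_m.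
Proof.
move=> le_mn; rewrite coefM /=; apply: eq_bigr => -[i /= lt_i] _.
by rewrite !coef_poly !ifT//; lia.
Qed.

Lemma fpsM_coef f g n (p r : {poly R}) :
  (forall i, (i <= n)%N -> p`_i = fcoef f i) ->
  (forall i, (i <= n)%N -> r`_i = fcoef g i) ->
  fcoef (fpsM f g) n = (p * r)`_n.
Proof.
move=> pf rg; rewrite coefM /=; apply: eq_bigr => -[i /= lt_i] _.
by rewrite pf ?rg//; lia.
Qed.

Lemma coef_trunc f n i : (i <= n)%N -> (\poly_(j < n.+1) fcoef f j)`_i = fcoef f i.
Proof. by move=> le_in; rewrite coef_poly ltnS le_in. Qed.

Lemma fpsMA : associative fpsM.
Proof.
move=> f g h; apply: fpsP => n.
pose t f := \poly_(j < n.+1) fcoef f j.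
rewrite (fpsM_coef (p := t f) (r := t g * t h)); last first.
- by move=> i le_in; rewrite -fpsM_poly.
- by move=> i le_in; rewrite coef_trunc.
rewrite (fpsM_coef (p := t f * t g) (r := t h)) ?mulrA//.
- by move=> i le_in; rewrite -fpsM_poly.
- by move=> i le_in; rewrite coef_trunc.
Qed.

Lemma fpsMC : commutative fpsM.
Proof. by move=> f g; apply: fpsP => n; rewrite !(fpsM_poly _ _ (leqnn n)) mulrC. Qed.

Lemma fps1M : left_id fps1 fpsM.
Proof.
move=> f; apply: fpsP => n /=.
rewrite big_ord_recl /= subn0 mul1r big1 ?addr0// => i _.
by rewrite /= mul0r.
Qed.

Lemma fpsMDl : left_distributive fpsM fpsD.
Proof.
move=> f g h; apply: fpsP => n /=; rewrite -big_split /=.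
by apply: eq_bigr => i _; rewrite mulrDl.
Qed.

Lemma fps1_neq0 : fps1 != 0 :> fps R.
Proof.
by apply/eqP => /(congr1 (fun f => fcoef f 0)) /= /eqP; rewrite oner_eq0.
Qed.

HB.instance Definition _ := GRing.Zmodule_isComNzRing.Build (fps R)
  fpsMA fpsMC fps1M fpsMDl fps1_neq0.

Lemma fcoef0 n : fcoef (0 : fps R) n = 0. Proof. by []. Qed.
Lemma fcoef1 n : fcoef (1 : fps R) n = (n == 0%N)%:R. Proof. by []. Qed.
Lemma fcoefX n : fcoef fpsX n = (n == 1%N)%:R. Proof. by []. Qed.
Lemma fcoefN f n : fcoef (- f) n = - fcoef f n. Proof. by []. Qed.
Lemma fcoefD f g n : fcoef (f + g) n = fcoef f n + fcoef g n. Proof. by []. Qed.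
Lemma fcoefM f g n :
  fcoef (f * g) n = \sum_(i < n.+1) fcoef f i * fcoef g (n - i).
Proof. by []. Qed.

Lemma fcoefMXn f m n : fcoef (fpsX ^+ m * f) n = if (n < m)%N then 0 else fcoef f (n - m).
Proof.
elim: m n => [|m IHm] n; first by rewrite expr0 mul1r subn0.
rewrite exprS -mulrA; move: (_ * f) IHm => g IHm; rewrite fcoefM.
case: n => [|n].
  by rewrite big_ord_recl big_ord0 fcoefX /= mul0r addr0.
rewrite 2!big_ord_recl !fcoefX /= mul0r mul1r add0r subn1 /= IHm ltnS subSS.
by rewrite big1 ?addr0// => i _; rewrite /= mul0r.
Qed.

Lemma fcoefXn m n : fcoef (fpsX ^+ m) n = (n == m)%:R.
Proof.
rewrite -[fpsX ^+ m]mulr1 fcoefMXn fcoef1 subn_eq0 eqn_leq.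
by case: (ltnP n m) => [|_]; rewrite ?andbT // andbF.
Qed.

(* First [n.+1] coefficients of the inverse, by the usual recursion
   g_0 = 1 / f_0 and g_n = - (\sum_(i < n) g_i f_(n - i)) / f_0. *)
Fixpoint fps_inv_seq f n : seq R :=
  if n is m.+1 then
    let s := fps_inv_seq f m in
    rcons s (- (\sum_(i < n) s`_i * fcoef f (n - i)) / fcoef f 0)
  else [:: (fcoef f 0)^-1].

Definition fps_unit : pred (fps R) := fun f => fcoef f 0 \is a GRing.unit.

Definition fps_inv f : fps R :=
  if fps_unit f then Fps (fun n => (fps_inv_seq f n)`_n) else f.

Lemma size_fps_inv_seq f n : size (fps_inv_seq f n) = n.+1.
Proof. by elim: n => //= n IHn; rewrite size_rcons IHn. Qed.

Lemma nth_fps_inv_seq f n i : (i <= n)%N ->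
  (fps_inv_seq f n)`_i = (fps_inv_seq f i)`_i.
Proof.
elim: n => [|n IHn]; first by rewrite leqn0 => /eqP ->.
rewrite leq_eqVlt => /orP[/eqP ->//|lt_in].
by rewrite /= nth_rcons size_fps_inv_seq lt_in IHn.
Qed.

Lemma fps_mulVr : {in fps_unit, left_inverse 1 fps_inv *%R}.
Proof.
move=> f uf; apply: fpsP => n; rewrite fcoef1 fcoefM /fps_inv (uf : fps_unit f) /=.
case: n => [|n]; first by rewrite big_ord_recl big_ord0 addr0 /= mulVr.
rewrite big_ord_recr /= subnn nth_rcons size_fps_inv_seq ltnn eqxx.
rewrite divrK//; apply/eqP; rewrite subr_eq0; apply/eqP/eq_bigr => -[i /= lt_i] _.
by rewrite [in RHS]nth_fps_inv_seq.
Qed.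

Lemma fps_unitPl f g : g * f = 1 -> fps_unit f.
Proof.
move=> /(congr1 (fun f => fcoef f 0)); rewrite fcoefM big_ord_recl big_ord0 addr0.
by rewrite subn0 => gf; apply/unitrP; exists (fcoef g 0); split; [|rewrite mulrC]; exact: gf.
Qed.

Lemma fps_inv_out : {in [predC fps_unit], fps_inv =1 id}.
Proof. by move=> f; rewrite inE /fps_inv => /negbTE nf; rewrite ifF. Qed.

HB.instance Definition _ := GRing.ComNzRing_hasMulInverse.Build (fps R)
  fps_mulVr fps_unitPl fps_inv_out.

(* Sum of a family in which every power of q occurs in only finitely many
   terms; the coefficients are finitely supported sums. *)
Definition fps_sum (I : choiceType) (A : set I) (F : I -> fps R) : fps R :=
  Fps (fun n => \sum_(i \in A) fcoef (F i) n).

Definition fps_summable (I : choiceType) (A : set I) (F : I -> fps R) : Prop :=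
  forall n, finite_set (A `&` [set i | fcoef (F i) n != 0])%classic.

End FpsRing.

Notation q := (fpsX int).

(* (q^2; q^2)_m *)
Definition qpoch2 (m : nat) : fps int := \prod_(1 <= i < m.+1) (1 - q ^+ (2 * i)).

(* The indices (N_1, ..., N_(k-1)) are the nonincreasing tuples. *)
Definition partitions (k : nat) : set (k.-1.-tuple nat) :=
  [set N | sorted geq N]%classic.

(* N_j.  The conventions N_j = 0 for j >= k and N_0 = N_1 hold because of the
   default value of [nth] and because 0.-1 = 0. *)
Definition part (k : nat) (N : k.-1.-tuple nat) (j : nat) : nat := nth 0%N N j.-1.

Definition diffpart (k : nat) (N : k.-1.-tuple nat) (i : nat) : nat :=
  (part N i - part N i.+1)%N.

Definition denominator (k : nat) (N : k.-1.-tuple nat) : fps int :=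
  \prod_(1 <= i < k) qpoch2 (diffpart N i).

Definition exponent_odd (k a : nat) (N : k.-1.-tuple nat) : nat :=
  (\sum_(1 <= i < k) part N i ^ 2
   + \sum_(2 <= i < a - 2 | ~~ odd i) diffpart N i
   + \sum_(a - 1 <= i < k) part N i)%N.

Definition exponent_even (k a : nat) (N : k.-1.-tuple nat) : nat :=
  (\sum_(1 <= i < k) part N i ^ 2
   + \sum_(2 <= i < a - 1 | ~~ odd i) diffpart N i
   + \sum_(a <= i < k) part N i)%N.

Lemma qpoch2_unit m : qpoch2 m \is a GRing.unit.
Proof.
rewrite /qpoch2 big_nat; apply: rpred_prod => i /andP[i0 _].
change (fcoef (1 - q ^+ (2 * i)) 0 \is a GRing.unit).
rewrite fcoefD fcoefN fcoef1 fcoefXn (_ : (0 == 2 * i)%N = false) ?subr0//.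
by lia.
Qed.

Lemma denominator_unit k (N : k.-1.-tuple nat) : denominator N \is a GRing.unit.
Proof. by apply: rpred_prod => i _; exact: qpoch2_unit. Qed.

Lemma summable_Xn_mul k (e : k.-1.-tuple nat -> nat) (F : k.-1.-tuple nat -> fps int) :
  (forall N, \sum_(1 <= i < k) part N i ^ 2 <= e N)%N ->
  fps_summable (@partitions k) (fun N => q ^+ e N * F N).
Proof.
move=> le_e n.
pose f (t : k.-1.-tuple 'I_n.+1) : k.-1.-tuple nat := [tuple of map val t].
have fin : finite_set (f @` setT)%classic by apply: finite_image; exact: finite_finset.
apply: sub_finite_set fin => N [_]; rewrite /mkset fcoefMXn.
case: ltnP => [|le_en _]; first by rewrite eqxx.
have Nn i : (tnth N i <= n)%N.
  apply: leq_trans le_en; apply: leq_trans (le_e N).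
  have ltik : (i.+1 < k)%N by have := ltn_ord i; lia.
  rewrite (bigD1_seq i.+1) ?iota_uniq ?mem_index_iota//=.
  by rewrite /part /= -tnth_nth; nia.
exists [tuple inord (tnth N i) | i < k.-1] => //.
by apply: eq_from_tnth => i; rewrite tnth_map tnth_mktuple [val _]inordK ?ltnS.
Qed.

Lemma summable_odd k a : fps_summable (@partitions k)
  (fun N => q ^+ exponent_odd a N / denominator N).
Proof. by apply: summable_Xn_mul => N; rewrite /exponent_odd -addnA leq_addr. Qed.

Lemma summable_even k a : fps_summable (@partitions k)
  (fun N => q ^+ exponent_even a N / denominator N).
Proof. by apply: summable_Xn_mul => N; rewrite /exponent_even -addnA leq_addr. Qed.

(* Main.v *)
Require Import Defs.
From mathcomp Require Import all_boot all_order all_algebra.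
From mathcomp Require Import finmap zify ring.
From mathcomp Require Import boolp classical_sets functions cardinality fsbigop.
Import GRing.Theory.
Local Open Scope ring_scope.

(** Mark the number of peaks of a path by z and the largest part N_1 of a
    partition by z as well.  Both sides then become families of series in z and
    q, and the theorem holds because they satisfy the same q-difference system.

    For the paths, the family is indexed by the starting height and by the
    parity of the starting abscissa.  Deleting the first step moves the origin by
    one, which replaces z by zq and flips the parity.  The only nonlocal datum,
    whether the deleted step went up, can be eliminated
    ([path_gf_two_steps]).  If E_h and O_h are the series for an even and an odd
    start at height h, this gives, with the obvious changes at the two ends,
      E_h(z) = O_(h+1)(zq) + O_(h-1)(zq) + (zq - 1) E_h(zq^2),
      O_h(z) = E_(h+1)(zq) + E_(h-1)(zq) - O_h(zq^2).

    For the multiple sums, let H_j be the one with exponent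
    N_1^2 + N_2^2 + ... + n_(j-2) + n_(j-4) + ... + N_j + N_(j+1) + ...; the
    theorem is about H_j with j the even number among a and a - 1.  These satisfy
      H_j(z) = H_(j-1)(zq) + H_(j+1)(zq) + (zq [j even] - 1) H_j(zq^2)
    ([multisum_rec]), by induction on the number of variables after splitting off
    N_1, together with H_0(z) = H_1(zq), H_1(z) = H_2(zq) and
    H_(k+1) = H_(k-1) at the boundary.  Matching E_(k-a) with H_j for the even j
    in {a - 1, a} and O_(k-a) with H_j for the odd one turns one system into the
    other ([path_series_rec]).

    The coefficient of z^0 is 1 on both sides.  For the coefficient of z^m with
    m > 0 every unknown on the right of the system carries a positive power of q,
    so the solution is unique, one power of q at a time ([path_gf_cvg]).
    Summing over m gives the theorem. *)

Set Implicit Arguments.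
Unset Strict Implicit.
Unset Printing Implicit Defensive.

(** * The multiple sum, one largest part at a time *)

Lemma qpoch2S m : qpoch2 m.+1 = qpoch2 m * (1 - q ^+ (2 * m.+1)).
Proof. by rewrite /qpoch2 big_nat_recr. Qed.

Lemma qpoch2_0 : qpoch2 0 = 1.
Proof. by rewrite /qpoch2 big_nil. Qed.

Lemma qpoch2_div m : (1 - q ^+ (2 * m.+1)) / qpoch2 m.+1 = (qpoch2 m)^-1.
Proof.
have := qpoch2_unit m.+1; rewrite qpoch2S unitrM => /andP[um uq].
by rewrite invrM // mulrA mulrV // mul1r.
Qed.

(** The effect on the sum over partitions of putting a new part [m] in front of
    the largest part [r]: the exponent gains the square of [m] and, if [e], the
    difference [m - r]. *)
Definition add_largest_part (e : bool) (f : nat -> fps int) (m : nat) : fps int :=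
  q ^+ (m ^ 2) * \sum_(r < m.+1) q ^+ (e * (m - r)) / qpoch2 (m - r) * f r.

(** [multisum l j m] collects the terms with [l] variables and largest part
    N_1 = [m] of the multiple sum whose exponent, besides the squares, is
    n_(j-2) + n_(j-4) + ... + (N_j + N_(j+1) + ...); lemma [multisumE] makes this
    precise.  Removing N_1 shifts the indices by one, so it lowers both [l] and
    [j]; the difference N_1 - N_2 occurs exactly when [j] is odd.  For
    [j] = 0 the convention N_0 = N_1 gives one more N_1 than for [j] = 1. *)
Fixpoint multisum (l j m : nat) : fps int :=
  match l, j with
  | 0, _ => (m == 0%N)%:R
  | l'.+1, 0 => q ^+ m * add_largest_part true (multisum l' 0) m
  | l'.+1, j'.+1 => add_largest_part (odd j) (multisum l' j') m
  end.

Lemma multisumS l j m : multisum l.+1 j.+1 m = add_largest_part (odd j.+1) (multisum l j) m.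
Proof. by []. Qed.

Lemma multisum0 l m : multisum l 0 m = q ^+ m * multisum l 1 m.
Proof. by case: l => [|l] //; case: m => [|m]; rewrite ?expr0 ?mul1r ?mulr0. Qed.

Lemma multisum1 l m : multisum l 1 m = q ^+ m * multisum l 2 m.
Proof.
case: l => [|l]; first by case: m => [|m]; rewrite ?expr0 ?mul1r ?mulr0.
rewrite !multisumS /add_largest_part mulrCA; congr (_ * _); rewrite mulr_sumr.
apply: eq_bigr => r _; rewrite multisum0 /= mul0n mul1n expr0 mul1r.
have -> : q ^+ m = q ^+ (m - r) * q ^+ r by rewrite -exprD subnK // -ltnS.
by ring.
Qed.

(** The last difference n_l is the last part N_l itself, so two exponents whose
    indices straddle the number of variables coincide. *)
Lemma multisum_bottom l m : multisum l l.+2 m = multisum l l m.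
Proof.
elim: l m => [|l IH] m //; rewrite !multisumS /add_largest_part.
by congr (_ * _); apply: eq_bigr => r _; rewrite IH /= negbK.
Qed.

(** The next three identities are the algebra of the induction step of
    [multisum_rec], with y = q^(m-r), x = q^r and c the reciprocal of the
    Pochhammer factor. *)
Fact odd_step (y x c f b g h : fps int) : x * h = (1 + x * x) * f - b * g ->
  (1 + y * x * (y * x)) * (y * c * f) - y * x * (c * h) =
  y * c * ((y * x * (y * x) - x * x) * f + b * g).
Proof.
move=> Er; have -> : y * x * (c * h) = y * c * (x * h) by ring.
by rewrite Er; ring.
Qed.

Fact even_step (y x c f h : fps int) : x * h = (1 + x * x) * f ->
  (1 + y * x * (y * x)) * (c * f) - y * x * (y * c * h) = (1 - y * y) * c * f.
Proof.
move=> Er; have -> : y * x * (y * c * h) = y * y * c * (x * h) by ring.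
by rewrite Er; ring.
Qed.

Fact telescope_step (y x c f : fps int) :
  y * c * ((y * x * (y * x) - x * x) * f) = - (y * x * x * ((1 - y * y) * c) * f).
Proof. ring. Qed.

(** The q-difference system of the multiple sums, read on the coefficient of
    z^m when z marks N_1.  Split off the largest part m of both sides and let r
    be the next one.  The same relation for one variable less and index j - 1
    eliminates the neighbours j - 2 and j.  When j is even this leaves the factor
    1 - q^(2(m-r)), which cancels a factor of the Pochhammer denominator and turns
    m into m - 1: this is the inhomogeneous term.  When j is odd the inner
    relation has an inhomogeneous term itself, and the sum over r telescopes. *)
Lemma multisum_rec l j m : (0 < j <= l.+1)%N ->
  (1 + q ^+ (2 * m)) * multisum l j m =
  q ^+ m * (multisum l j.-1 m + multisum l j.+1 m)
  + (~~ odd j && (0 < m)%N)%:R * (q ^+ (2 * m).-1 * multisum l j m.-1).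
Proof.
elim: l j m => [|l IH] [|[|j]] m // jl.
- rewrite mul0r addr0 /=.
  by case: m => [|m]; rewrite ?expr0 ?mulr0 ?mul1r ?mulr1 ?addr0.
- by rewrite [_.-1]/= multisum0 multisum1 mul0r addr0 mulnC exprM; ring.
have {IH jl} IH r : q ^+ r * (multisum l j r + multisum l j.+2 r) =
    (1 + q ^+ (2 * r)) * multisum l j.+1 r
    - (odd j && (0 < r)%N)%:R * (q ^+ (2 * r).-1 * multisum l j.+1 r.-1).
  by rewrite IH //= negbK addrK.
rewrite [_.-1]/= !multisumS /add_largest_part /= negbK.
set f := multisum l j.+1 in IH *; set c := fun d => (qpoch2 d)^-1.
case: (odd j) IH => /= IH.
  rewrite mul0r addr0 -mulrDr -big_split /= !(mulrCA _ (q ^+ (m ^ 2))).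
  congr (_ * _); rewrite !mulr_sumr; apply/eqP; rewrite -subr_eq0 -sumrB.
  (* g r is the contribution of f r.-1; the relation above produces at r both
     g r and the negative of g r.+1 *)
  pose g r := if (0 < r <= m)%N then q ^+ (m + r.-1) * c (m - r)%N * f r.-1 else 0.
  rewrite (eq_bigr (fun r : 'I_m.+1 => - (g r.+1 - g r))); last first.
    move=> [r /= ltr] _; rewrite mul1n mul0n expr0 -/(c _).
    have /subnK : (r <= m)%N by []. move: (m - r)%N => d dE.
    transitivity (q ^+ d * c d * ((q ^+ (2 * m) - q ^+ (2 * r)) * f r
        + (0 < r)%:R * (q ^+ (2 * r).-1 * f r.-1))).
      rewrite mul1r -mulrDr -dE; have := IH r; rewrite !mul2n -!addnn !exprD.
      exact: odd_step.
    rewrite opprB mulrDr addrC; congr (_ + _).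
      rewrite /g -dE; case: r {ltr dE} => [|r]; first by rewrite mul0r mulr0.
      rewrite leq_addl addnK mul1r mulrCA mulrA; congr (_ * _).
      rewrite mulrCA mulrC mulrAC -exprD; congr (q ^+ _ * _); lia.
    rewrite /g -dE; case: d {dE} => [|d]; first by rewrite ltnn subrr mul0r mulr0 oppr0.
    have -> : (0 < r.+1 <= d.+1 + r)%N by lia.
    have -> : (d.+1 + r - r.+1 = d)%N by lia.
    rewrite [r.+1.-1]/= -[c d]qpoch2_div -/(c _).
    rewrite !mul2n -!addnn !exprD.
    exact: telescope_step.
  rewrite sumrN -(big_mkord xpredT (fun r => g r.+1 - g r)) telescope_sumr //.
  by rewrite /g ltnn subrr oppr0.
rewrite -mulrDr -big_split /= !(mulrCA _ (q ^+ (m ^ 2))).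
apply/eqP; rewrite [eqbRHS]addrC -subr_eq -mulrBr !mulr_sumr -sumrB; apply/eqP.
(* the term r = m vanishes and the others lose one Pochhammer factor *)
rewrite (eq_bigr (fun r : 'I_m.+1 => (1 - q ^+ (2 * (m - r))) * c (m - r)%N * f r)); last first.
  move=> [r /= ltr] _; rewrite mul1n mul0n expr0 -/(c _).
  have /subnK : (r <= m)%N by []. move: (m - r)%N => d dE.
  rewrite mul1r -mulrDr -dE; have := IH r; rewrite mul0r subr0 !mul2n -!addnn !exprD.
  exact: even_step.
rewrite big_ord_recr /= subnn muln0 subrr !mul0r addr0.
case: m => [|m]; first by rewrite big_ord0 mulr0 big1 // => r _; rewrite ltnn mul0r.
rewrite -!mulr_sumr [X in _ = X]mul1r [RHS]mulrA -exprD; congr (q ^+ _ * _); first lia.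
apply: eq_bigr => -[r /= ltr] _; rewrite subSn // -[in RHS]qpoch2_div.
by rewrite mul0n expr0 mul1r.
Qed.

(** * The multiple sum as a sum over partitions *)

Fixpoint partitions_from l m : seq (l.-tuple nat) :=
  if l is l'.+1 then
    [seq cons_tuple m s | r <- iota 0 m.+1, s <- partitions_from l' r]
  else if m == 0%N then [:: [tuple]] else [::].

Lemma mem_partitions_from l m (s : l.-tuple nat) :
  (s \in partitions_from l m) = sorted geq s && (head 0%N s == m).
Proof.
elim: l m s => [|l IH] m s.
  by rewrite (tuple0 s) /= eq_sym; case: ifP.
apply/allpairsPdep/idP => [[r [t [rin tin ->]]]|].
  have {rin} lerm : (r <= m)%N by move: (rin : r \in iota 0 m.+1); rewrite mem_iota.
  move: tin; rewrite IH => /andP[+ /eqP rE]; rewrite eqxx andbT.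
  case: t rE => -[|x t] //= _ xr; rewrite xr => ->; rewrite andbT.
  exact: lerm.
case/tupleP: s => x t /= /andP[sx /eqP xm]; exists (head 0%N t), t; split.
- change (head 0%N t \in iota 0 m.+1); rewrite mem_iota add0n ltnS -xm /=.
  by case: t sx => -[|y t] //= _ /andP[].
- by rewrite IH eqxx andbT (path_sorted sx).
- by apply: val_inj; rewrite /= xm.
Qed.

Lemma partitions_from_uniq l m : uniq (partitions_from l m).
Proof.
elim: l m => [|l IH] m; first by rewrite /=; case: ifP.
apply: allpairs_uniq_dep => [|r _|]; [exact: iota_uniq | exact: IH |].
move=> [r1 s1] [r2 s2] /allpairsPdep[a [b [_ bin [-> ->]]]].
move=> /allpairsPdep[c [d [_ din [-> ->]]]] /= [/val_inj bd].
by move: bin din; rewrite !mem_partitions_from bd => /andP[_ /eqP->] /andP[_ /eqP->].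
Qed.

(** The parity condition selects n_(j-2), n_(j-4), ...; for even [j] this is
    the exponent of the theorem with a = j or a = j + 1. *)
Definition exponent j l (s : l.-tuple nat) : nat :=
  (\sum_(1 <= i < l.+1) @part l.+1 s i ^ 2
   + \sum_(1 <= i < j.-1 | odd i == odd j) @diffpart l.+1 s i
   + \sum_(j <= i < l.+1) @part l.+1 s i)%N.

Lemma exponent0 l (s : l.-tuple nat) : exponent 0 s = (head 0%N s + exponent 1 s)%N.
Proof.
rewrite /exponent /= [(\sum_(0 <= i < l.+1) _)%N]big_ltn // !(big_geq (m := 1) (n := 0)) //.
have -> : @part l.+1 s 0 = head 0%N s by rewrite /part nth0.
lia.
Qed.

Lemma exponent_cons j m l (s : l.-tuple nat) : (head 0 s <= m)%N ->
  exponent j.+1 (cons_tuple m s) =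
  (m ^ 2 + odd j.+1 * (m - head 0 s) + exponent j s)%N.
Proof.
move=> rm; have sqE : (\sum_(1 <= i < l.+2) @part l.+2 (cons_tuple m s) i ^ 2 =
  m ^ 2 + \sum_(1 <= i < l.+1) @part l.+1 s i ^ 2)%N.
  rewrite big_ltn // big_add1; congr (_ + _)%N.
  by apply: eq_big_nat => -[|i].
have tailE i0 : (0 < i0)%N -> (\sum_(i0.+1 <= i < l.+2) @part l.+2 (cons_tuple m s) i =
  \sum_(i0 <= i < l.+1) @part l.+1 s i)%N.
  move=> i0_gt0; rewrite big_add1; apply: eq_big_nat => -[|i] //.
  by case: i0 i0_gt0.
case: j => [|j]; rewrite ?exponent0 /exponent sqE.
  rewrite !(big_geq (m := 1) (n := 0)) // [(\sum_(1 <= i < l.+2) _)%N]big_ltn // tailE //.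
  have -> : @part l.+2 (cons_tuple m s) 1 = m by []. lia.
rewrite tailE // [j.+2.-1]/= [j.+1.-1]/=.
case: j => [|j].
  rewrite (big_geq (m := 1) (n := 1)) // (big_geq (m := 1) (n := 0)) //.
  by rewrite (mul0n : forall n, odd 2 * n = 0)%N; lia.
rewrite [(\sum_(1 <= i < j.+2 | _) _)%N]big_ltn_cond //.
have -> : (\sum_(2 <= i < j.+2 | odd i == odd j.+3)
    @diffpart l.+2 (cons_tuple m s) i =
  \sum_(1 <= i < j.+1 | odd i == odd j.+2) @diffpart l.+1 s i)%N.
  rewrite big_add1; apply: congr_big_nat => // -[|i] //.
    by rewrite !oddS eqb_negLR negbK.
  by rewrite andbF.
have -> : @diffpart l.+2 (cons_tuple m s) 1 = (m - head 0 s)%N.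
  by rewrite /diffpart /part /= nth0.
rewrite (_ : odd 1 = true) //; case: (odd j.+3) => /=; lia.
Qed.

Lemma denominator_cons l m (s : l.-tuple nat) :
  @denominator l.+2 (cons_tuple m s) =
  qpoch2 (m - head 0%N s) * @denominator l.+1 s.
Proof.
rewrite /denominator big_ltn // big_add1; congr (qpoch2 _ * _).
by apply: eq_big_nat => -[|i].
Qed.

Lemma sum_partitions_from_cons l m (F : l.+1.-tuple nat -> fps int) :
  \sum_(s <- partitions_from l.+1 m) F s =
  \sum_(r < m.+1) \sum_(s <- partitions_from l r) F (cons_tuple m s).
Proof.
rewrite -(big_mkord xpredT (fun r => \sum_(s <- partitions_from l r) _)) /index_iota subn0.
by rewrite big_allpairs_dep.
Qed.

Lemma multisumE l j m : multisum l j m =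
  \sum_(s <- partitions_from l m) q ^+ exponent j s / @denominator l.+1 s.
Proof.
elim: l j m => [|l IH] j m.
  rewrite /=; case: ifP => _; last by rewrite big_nil.
  rewrite big_seq1 /exponent /denominator !(big_geq (m := 1) (n := 1)) // divr1.
  by rewrite !big1 ?expr0 // => i _; rewrite /diffpart /part ?nth_nil.
have step i : add_largest_part (odd i.+1) (multisum l i) m =
    \sum_(s <- partitions_from l.+1 m) q ^+ exponent i.+1 s / @denominator l.+2 s.
  rewrite /add_largest_part mulr_sumr sum_partitions_from_cons.
  apply: eq_bigr => -[r /= ltr] _; rewrite IH !mulr_sumr big_seq [RHS]big_seq.
  apply: eq_bigr => s; rewrite mem_partitions_from => /andP[_ /eqP sr].
  rewrite exponent_cons sr // denominator_cons sr invrM ?qpoch2_unit ?denominator_unit //.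
  move: (exponent i s) => x; rewrite !exprD; ring.
case: j => [|j]; last exact: step.
rewrite /= (step 0%N) mulr_sumr big_seq [RHS]big_seq; apply: eq_bigr => s.
by rewrite mem_partitions_from => /andP[_ /eqP sr]; rewrite exponent0 sr exprD mulrA.
Qed.

Lemma fcoef_sum (I : Type) (r : seq I) (F : I -> fps int) n :
  fcoef (\sum_(i <- r) F i) n = \sum_(i <- r) fcoef (F i) n.
Proof.
by elim/big_rec2: _ => // i x y _ <-; rewrite fcoefD.
Qed.

(** A partition with N_1 = m has exponent at least m^2 >= m, so only those with
    N_1 <= n contribute to the coefficient of q^n. *)
Lemma fcoef_fps_sum l j n :
  fcoef (fps_sum (@partitions l.+1) (fun N => q ^+ @exponent j l N / denominator N)) n
  = \sum_(m < n.+1) fcoef (multisum l j m) n.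
Proof.
pose r := [seq s | m <- iota 0 n.+1, s <- partitions_from l m].
have mem_r (s : l.-tuple nat) : (s \in r) = sorted geq s && (head 0%N s <= n)%N.
  apply/allpairsPdep/andP => [[m [t [+ + ->]]]|[ss hs]].
    by rewrite mem_partitions_from => mn /andP[-> /eqP->]; move: mn; rewrite mem_iota.
  by exists (head 0%N s), s; rewrite mem_partitions_from ss eqxx mem_iota add0n ltnS.
have uniq_r : uniq r.
  apply: allpairs_uniq_dep => [|m _|]; [exact: iota_uniq | exact: partitions_from_uniq |].
  move=> [m1 s1] [m2 s2] /allpairsPdep[a [b [_ bin [-> ->]]]].
  move=> /allpairsPdep[c [d [_ din [-> ->]]]] /= bd.
  by move: bin din; rewrite !mem_partitions_from bd => /andP[_ /eqP->] /andP[_ /eqP->].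
rewrite [LHS]/= (fsbigE r) //.
- rewrite big_seq_cond (eq_bigl (fun s => s \in r)); last first.
    by move=> s; rewrite andb_idr // mem_r => /andP[ss _]; rewrite inE.
  rewrite -big_seq big_allpairs_dep /= -(big_mkord xpredT (fun m => fcoef (multisum l j m) n)).
  by rewrite /index_iota subn0; apply: eq_bigr => m _; rewrite multisumE fcoef_sum.
- by move=> s /=; rewrite mem_r => /andP[].
- move=> s ss; rewrite mem_r (ss : sorted geq s) -ltnNge /= => lt_n.
  rewrite -fcoefM fcoefMXn ifT //; apply: leq_trans lt_n _.
  case: l s {mem_r uniq_r r ss} => [|l] s; first by rewrite (tuple0 s).
  by rewrite /exponent big_ltn // -!addnA {1}/part /= nth0; nia.
Qed.

(** * Lattice paths as words of up and down steps *)

Fixpoint words (B : nat) : seq (seq bool) :=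
  [::] :: if B is B'.+1 then
    map (cons true) (words B') ++ map (cons false) (words B') else [::].

Lemma mem_words B w : (w \in words B) = (size w <= B)%N.
Proof.
elim: B w => [|B IH] [|b w] //=; rewrite inE /= mem_cat ltnS -IH.
have memc c : (b :: w \in map (cons c) (words B)) = (b == c) && (w \in words B).
  apply/mapP/andP => [[v vin [-> ->]]|[/eqP-> win]]; first by [].
  by exists w.
by rewrite !memc; case: (b); rewrite /= ?orbF.
Qed.

Lemma words_uniq B : uniq (words B).
Proof.
elim: B => [|B IH] //=; rewrite mem_cat cat_uniq !map_inj_uniq ?IH ?andbT; try by move=> ? ? [].
rewrite negb_or -andbA; apply/and3P; split.
- by apply/mapP => -[].
- by apply/mapP => -[].
- by rewrite andTb -all_predC; apply/allP => _ /mapP[v _ ->] /=; apply/mapP => -[].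
Qed.

(** A step is encoded by a boolean: [true] is North-East, and [false] is
    South-East above the axis and East on it; truncated subtraction gives the new
    height in both cases. *)
Definition next_height (b : bool) (h : nat) : nat := if b then h.+1 else h.-1.

(** Requiring a nonempty rest after an East step says that a nonempty path ends
    with a South-East step. *)
Fixpoint valid (k h : nat) (w : seq bool) : bool :=
  (h < k)%N && if w is b :: w' then
    [|| (0 < h)%N, b | w' != [::]] && valid k (next_height b h) w'
  else h == 0%N.

(** The abscissas of the peaks relative to the start; [up] tells whether the
    step before the start was North-East, in which case the start itself can be a
    peak. *)
Fixpoint peakpos (up : bool) (w : seq bool) : seq nat :=
  if w is b :: w' then
    nseq (up && ~~ b) 0%N ++ [seq x.+1 | x <- peakpos b w']
  else [::].

(** [p] is the parity of the absolute abscissa of the start, so that the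
    condition on the peaks says that their absolute abscissas are odd. *)
Definition admissible (k : nat) (p up : bool) (h m : nat) (w : seq bool) : bool :=
  [&& valid k h w, all (fun x => odd x (+) p) (peakpos up w)
    & size (peakpos up w) == m].

(** Paths with at most [B] steps, so that the sum is finite; the recursion on
    paths becomes a recursion on [B]. *)
Definition path_gf (k m B : nat) (p up : bool) (h : nat) : fps int :=
  \sum_(w <- words B | admissible k p up h m w) q ^+ sumn (peakpos up w).

Lemma valid_ge k h w : (k <= h)%N -> valid k h w = false.
Proof. by move=> kh; case: w => [|b w] /=; rewrite ltnNge kh. Qed.

Lemma path_gf_ge k m B p up h : (k <= h)%N -> path_gf k m B p up h = 0.
Proof. by move=> kh; rewrite /path_gf big1 // => w; rewrite /admissible valid_ge. Qed.

(** A North-East step must be followed by a peak sooner or later, and an East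
    step by a North-East one. *)
Lemma valid_no_peak k h up w :
  valid k h w -> peakpos up w = [::] -> w = nseq h false.
Proof.
suff: valid k h w -> peakpos up w = [::] -> w = nseq h false /\ (up -> h = 0%N).
  by move=> H /H{}H /H[].
elim: w h up => [|b w IH] h up /=; first by case/andP=> _ /eqP->.
case/andP=> _ /andP[h0 vw] pw.
have /(IH _ _ vw)[wE bh] : peakpos b w = [::].
  by case: (peakpos b w) pw => // x s; case: (nseq _ _).
case: b h0 vw pw wE bh => h0 vw pw wE bh; first by have := bh isT.
case: up pw => //= _; split=> //.
by case: h h0 {vw bh} wE => [|h] /= h0 wE; [rewrite wE in h0 | rewrite wE].
Qed.

Lemma peakpos_descent h : peakpos false (nseq h false) = [::].
Proof. by elim: h => //= h ->. Qed.

Lemma valid_descent k h : (h < k)%N -> valid k h (nseq h false).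
Proof. by elim: h => [|h IH] /= hk; rewrite hk //= IH // ltnW. Qed.

Lemma path_gf_no_peak k B p h : (h < k)%N -> (h <= B)%N -> path_gf k 0 B p false h = 1.
Proof.
move=> hk hB; rewrite /path_gf (eq_bigl (pred1 (nseq h false))); last first.
  move=> w /=; apply/and3P/eqP => [[vw _ /eqP/size0nil pw]|->].
    exact: valid_no_peak vw pw.
  by rewrite peakpos_descent valid_descent.
rewrite -big_filter filter_pred1_uniq ?words_uniq ?mem_words ?size_nseq //.
by rewrite big_seq1 peakpos_descent.
Qed.

Lemma sumn_map_succn s : sumn [seq x.+1 | x <- s] = (sumn s + size s)%N.
Proof. by elim: s => //= x s ->; rewrite addnS addSn addnA. Qed.

Lemma all_odd_succn p s :
  all (fun x => odd x (+) p) [seq x.+1 | x <- s] = all (fun x => odd x (+) ~~ p) s.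
Proof. by rewrite all_map; apply: eq_all => x /=; rewrite addNb addbN. Qed.

(** First-step decomposition.  Moving the origin by one adds 1 to the weight of
    each of the m peaks, hence the factor q^m, and flips the parity [p].  After a
    North-East step, going down creates a peak of weight 0, which must be allowed
    by [p]. The side condition excludes the starts on the axis that
    follow a North-East step, which do not occur, and those with no peak left,
    where the empty path is exceptional. *)
Lemma path_gf_first_step k m B p up h : (h < k)%N -> (0 < h)%N || ~~ up && (0 < m)%N ->
  path_gf k m B.+1 p up h = q ^+ m * path_gf k m B (~~ p) true h.+1 +
  (if up then (p && (0 < m)%N)%:R * (q ^+ m.-1 * path_gf k m.-1 B (~~ p) false h.-1)
   else q ^+ m * path_gf k m B (~~ p) false h.-1).
Proof.
move=> hk hm; rewrite /path_gf /= big_cons big_cat !big_map /=.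
rewrite [admissible _ _ _ _ _ [::]]/admissible /= hk ifF; last first.
  by case: h m hm {hk} => [|h] [|m] //=; rewrite !andbF.
congr (_ + _).
  rewrite mulr_sumr /admissible /= hk orbT andbF /=; apply: eq_big => w.
    by rewrite all_odd_succn size_map.
  by case/and3P=> _ _; rewrite size_map sumn_map_succn => /eqP <-; rewrite addnC exprD.
case: up hm => /= hm.
  rewrite orbF in hm.
  case: p => /=; last first.
    by rewrite mul0r big1 // => w; rewrite /admissible /= andbF.
  case: m => [|m].
    by rewrite mul0r big1 // => w; rewrite /admissible /= !andbF.
  rewrite mul1r mulr_sumr /admissible /= hk hm /=; apply: eq_big => w.
    by rewrite all_odd_succn size_map eqSS.
  case/and3P=> _ _; rewrite size_map eqSS => /eqP <-.
  by rewrite add0n sumn_map_succn addnC exprD.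
rewrite mulr_sumr /admissible /= hk /=; apply: eq_big => w.
  rewrite all_odd_succn size_map; case: ltnP hm => //= h0 m0.
  by case: w => //=; case: (m) m0 => // n _; rewrite /= !andbF.
by case/and3P=> _ _; rewrite size_map sumn_map_succn => /eqP <-; rewrite addnC exprD.
Qed.

(** Elimination of the paths that remember a previous North-East step: such
    paths differ from unrestricted ones only in what a downward first step
    contributes. *)
Lemma path_gf_two_steps k m B p h : (h < k)%N ->
  path_gf k m.+1 B.+2 p false h =
    q ^+ m.+1 * (if (h.+1 < k)%N then path_gf k m.+1 B.+1 (~~ p) false h.+1
         + (~~ p)%:R * (q ^+ m * path_gf k m B p false h)
         - q ^+ m.+1 * path_gf k m.+1 B p false h else 0)
    + q ^+ m.+1 * path_gf k m.+1 B.+1 (~~ p) false h.-1.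
Proof.
move=> hk; rewrite path_gf_first_step ?orbT //; congr (q ^+ _ * _ + _).
case: ltnP => hk1; last by rewrite path_gf_ge.
rewrite !(path_gf_first_step _ _ hk1) // negbK andbT [h.+1.-1]/= [m.+1.-1]/=; ring.
Qed.

(** * The path series satisfy the system of the multiple sums *)

(** The index of the multiple sum that counts the paths starting at height k - a
    at an abscissa of parity [p].  A step changes both the parity and [a] by one,
    and the system of the multiple sums relates neighbouring indices; so an even
    start gets the even number among a - 1 and a, and an odd start the odd one. *)
Definition multisum_index (p : bool) (a : nat) : nat :=
  if p then a.-1./2.*2.+1 else a./2.*2.

Definition path_series (l : nat) (p : bool) (a m : nat) : fps int :=
  multisum l (multisum_index p a) m.

Lemma multisum_no_part l j : multisum l j 0 = 1.
Proof.
have add_largest0 e f : add_largest_part e f 0 = f 0%N.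
  by rewrite /add_largest_part big_ord_recl big_ord0 addr0 muln0 qpoch2_0 divr1 !mul1r.
by elim: l j => [|l IH] [|j] //=; rewrite add_largest0 ?IH ?mulr1.
Qed.

(** The left-hand side is the series of the height just below k - a, which is
    k - a itself when k - a = 0; in that last case the indices may disagree and
    [multisum_bottom] reconciles them. *)
Lemma path_series_next l p a m : (1 < a <= l.+1)%N ->
  path_series l (~~ p) (if (a <= l)%N then a.+1 else a) m =
  multisum l (multisum_index p a).+1 m.
Proof.
move=> al; rewrite /path_series; set a' := if _ then _ else _.
have [-> //|[-> ->]] : multisum_index (~~ p) a' = (multisum_index p a).+1 \/
    multisum_index (~~ p) a' = l /\ (multisum_index p a).+1 = l.+2.
  by rewrite /a' /multisum_index; case: p; case: ifP => le_al /=; lia.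
by rewrite multisum_bottom.
Qed.

Fact solve_diagonal (y z b u v w x : fps int) :
  (1 + y * y) * v = y * (w + x) + b * (y * z * u) ->
  v = y * (w + b * (z * u) - y * v) + y * x.
Proof.
move=> E; transitivity ((1 + y * y) * v - y * y * v); first ring.
by rewrite E; ring.
Qed.

(** The recursion of [path_gf_two_steps], for the multiple sums. *)
Lemma path_series_rec l p a m : (0 < a <= l.+1)%N ->
  path_series l p a m.+1 =
    q ^+ m.+1 * (if (1 < a)%N then path_series l (~~ p) a.-1 m.+1
         + (~~ p)%:R * (q ^+ m * path_series l p a m)
         - q ^+ m.+1 * path_series l p a m.+1 else 0)
    + q ^+ m.+1 * path_series l (~~ p) (if (a <= l)%N then a.+1 else a) m.+1.
Proof.
move=> al; case: ifP => a1.
  rewrite path_series_next ?a1 //=; last by lia.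
  have jE : multisum_index (~~ p) a.-1 = (multisum_index p a).-1.
    by rewrite /multisum_index; case: (p) => /=; lia.
  rewrite /path_series jE; set j := multisum_index p a.
  have /(multisum_rec m.+1) : (0 < j <= l.+1)%N.
    by rewrite /j /multisum_index; case: (p); lia.
  have -> : odd j = p by rewrite /j /multisum_index; case: (p) => /=; rewrite odd_double.
  rewrite andbT mul2n -addnn addnS [_.+1.-1]/= [m.+1.-1]/= exprD.
  rewrite -addnS exprD; exact: solve_diagonal.
have -> : a = 1%N by lia.
rewrite mulr0 add0r /path_series.
case: p; case: l {al} => [|l]; first by rewrite [RHS]mulr0.
- exact: multisum1.
- exact: multisum0.
- exact: multisum0.
Qed.

Definition eq_upto (n : nat) (f g : fps int) := forall i, (i < n)%N -> fcoef f i = fcoef g i.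

Lemma eq_uptoD n f g f' g' : eq_upto n f f' -> eq_upto n g g' -> eq_upto n (f + g) (f' + g').
Proof. by move=> e1 e2 i lti; rewrite !fcoefD e1 ?e2. Qed.

Lemma eq_uptoN n f g : eq_upto n f g -> eq_upto n (- f) (- g).
Proof. by move=> e1 i lti; rewrite !fcoefN e1. Qed.

Lemma eq_uptoMXn n m f g : eq_upto n f g -> eq_upto (n + m) (q ^+ m * f) (q ^+ m * g).
Proof. by move=> e i lti; rewrite !fcoefMXn; case: ltnP => // mi; rewrite e //; lia. Qed.

Lemma eq_uptoMb n (b : bool) f g : eq_upto n f g -> eq_upto n (b%:R * f) (b%:R * g).
Proof. by case: b => e; rewrite ?mul1r // !mul0r. Qed.

Lemma eq_uptoW n m f g : (m <= n)%N -> eq_upto n f g -> eq_upto m f g.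
Proof. by move=> mn e i lti; apply: e; apply: leq_trans mn. Qed.

(** Both families satisfy the same recursion, in which every term on the right
    has a factor q^m, where m is the number of peaks, or fewer peaks.  For m > 0,
    agreement modulo q^n for all starting heights therefore improves to agreement
    modulo q^(n+1), once fewer peaks have been dealt with. *)
Lemma path_gf_cvg l m n : exists B0, forall B, (B0 <= B)%N -> forall p a,
  (0 < a <= l.+1)%N -> eq_upto n (path_gf l.+1 m B p false (l.+1 - a)) (path_series l p a m).
Proof.
elim: m n => [|m IHm] n.
  exists l.+1 => B lB p a al; rewrite /path_series multisum_no_part path_gf_no_peak //; lia.
elim: n => [|n [B1 IHn]]; first by exists 0%N.
have [B2 {}IHm] := IHm n.
exists (maxn B1 B2).+2 => -[|[|B]] // BB p a al.
have [le1 le2] : (B1 <= B)%N /\ (B2 <= B)%N by move: BB; rewrite !ltnS geq_max => /andP.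
rewrite path_series_rec // path_gf_two_steps; last lia.
have -> : ((l.+1 - a).+1 < l.+1)%N = (1 < a)%N by lia.
apply: (@eq_uptoW (n + m.+1)); first by lia.
apply: eq_uptoD; apply: eq_uptoMXn.
  case: ifP => // a1; apply: eq_uptoD; last first.
    by apply/eq_uptoN/(eq_uptoW (leq_addr _ _))/eq_uptoMXn/IHn.
  apply: eq_uptoD.
    rewrite (_ : (l.+1 - a).+1 = l.+1 - a.-1)%N; last lia.
    by apply: IHn; lia.
  by apply/eq_uptoMb/(eq_uptoW (leq_addr _ _))/eq_uptoMXn/IHm.
rewrite (_ : (l.+1 - a).-1 = l.+1 - if (a <= l)%N then a.+1 else a)%N; last by case: ifP; lia.
by apply: IHn; [lia | case: ifP; lia].
Qed.

(** * From words back to lattice paths *)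

Fixpoint trace (x h : nat) (w : seq bool) : seq vertex :=
  (x, h) :: if w is b :: w' then trace x.+1 (next_height b h) w' else [::].

Lemma size_trace x h w : size (trace x h w) = (size w).+1.
Proof. by elim: w x h => //= b w IH x h; rewrite IH. Qed.

Lemma traceE x h w : trace x h w = (x, h) :: behead (trace x h w).
Proof. by case: w. Qed.

Lemma next_height_inj h : injective (next_height^~ h).
Proof. by case=> -[] //=; rewrite /next_height; lia. Qed.

Lemma trace_inj x h : injective (trace x h).
Proof.
move=> w v; elim: w v x h => [|b w IH] [|c v] x h //= [].
- by rewrite traceE.
- by rewrite traceE.
move=> wv; have := congr1 (head (0, 0)%N) wv.
rewrite traceE [trace _ _ v]traceE /= => -[] hE.
have bc : b = c := next_height_inj hE.
by move: wv; rewrite bc => /IH->.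
Qed.

Lemma path_trace v p : path lattice_step v p -> exists w, v :: p = trace v.1 v.2 w.
Proof.
elim: p v => [|u p IH] v /=; first by exists [::]; case: v.
case/andP=> st /IH[w uw].
have [b [b1 b2]] : exists b, u.1 = v.1.+1 /\ u.2 = next_height b v.2.
  case/or3P: st => [/andP[/eqP-> /eqP->]|/andP[/eqP-> /eqP->]|/and3P[/eqP-> /eqP-> /eqP->]].
  - by exists true.
  - by exists false.
  - by exists false.
by exists (b :: w); rewrite /= uw b1 b2; case: v {st b1 b2 uw}.
Qed.

Lemma trace_step b h x : lattice_step (x, h) (x.+1, next_height b h).
Proof.
rewrite /lattice_step /northeast /southeast /east /next_height /= eqxx /=.
by case: b; case: h => [|h] //=; rewrite eqxx ?orbT.
Qed.

Lemma northeast_step b h x : northeast (x, h) (x.+1, next_height b h) = b.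
Proof. by rewrite /northeast /= eqxx /next_height; case: b => /=; lia. Qed.

Lemma valid_trace k x h w : valid k h w =
  [&& (last (x, h) (trace x h w)).2 == 0%N,
      (w == [::]) || southeast (nth (0, 0)%N (trace x h w) (size w).-1)
                             (last (x, h) (trace x h w))
    & all (fun v => height v < k)%N (trace x h w)].
Proof.
elim: w x h => [|b w IH] x h /=; first by rewrite /height /= andbT andbC.
rewrite (IH x.+1) /=; case: w IH => [|c w] IH /=.
  rewrite /next_height /southeast /height /= eqxx /= orbF andbT.
  case: b {IH} => //=; rewrite ?andbF //.
  by case: h => [|h] /=; rewrite ?andbF // eqxx andbCA.
by rewrite !orbT andTb andbCA; congr (_ && _); rewrite andbCA.
Qed.

(** Whether an index is a peak depends on the preceding vertex, so the induction
    runs over paths with an arbitrary vertex [u] in front. *)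
Lemma peaks_trace x h w :
  [seq i <- iota 0 (size (trace x h w)) | is_peak (trace x h w) i] = peakpos false w.
Proof.
have main : forall w u x h,
  [seq i <- iota 1 (size w).+1 | is_peak (u :: trace x h w) i] =
  [seq i.+1 | i <- peakpos (northeast u (x, h)) w].
  elim=> [|b {}w IH] u {}x {}h; first by rewrite /= /is_peak /= ?andbF.
  have -> : iota 1 (size (b :: w)).+1 = [:: 1%N] ++ map (addn 1) (iota 1 (size w).+1).
    by rewrite -iotaDl.
  rewrite filter_cat filter_map.
  rewrite [X in _ ++ map _ X](@eq_in_filter _ _ (is_peak (trace x h (b :: w)))); last first.
    by move=> i; rewrite mem_iota; case: i => // i _ /=; rewrite traceE.
  rewrite [trace x h (b :: w)]/= IH [peakpos _ (b :: w)]/= map_cat; congr (_ ++ _).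
    rewrite /is_peak /= traceE /=; case hu: (northeast u (x, h)) => //=.
    have {hu} h0 : (0 < h)%N by case/andP: hu => _ /= /eqP->.
    by rewrite /southeast /next_height /= eqxx; case: b h0 {IH} => //=;
      case: (h) => //= n; rewrite ?eqxx //; case: eqP => //; lia.
  by rewrite northeast_step.
case: w main => [|b w] main //.
rewrite [RHS]/=.
have := main w (x, h) x.+1 (next_height b h); rewrite northeast_step => <-.
by rewrite /= size_trace.
Qed.

Lemma lattice_path_trace h w :
  lattice_path (trace 0 h w) = ((last (0%N, h) (trace 0 h w)).2 == 0%N) &&
      ((w == [::]) || southeast (nth (0, 0)%N (trace 0 h w) (size w).-1)
                               (last (0%N, h) (trace 0 h w))).
Proof.
have pathP : path lattice_step (0%N, h) (behead (trace 0 h w)).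
  elim: w 0%N h => [|b w IH] x h //=; rewrite traceE /= trace_step.
  exact: IH.
rewrite traceE /= pathP /= -[last _ _]/(last (0%N, h) ((0%N, h) :: behead (trace 0 h w))) -traceE.
rewrite size_behead size_trace /=; congr (_ && (_ || _)).
  by case: w {pathP} => [|b w] //=; rewrite traceE.
case: w {pathP} => [|b w] //=.
congr (southeast _ _).
by apply: set_nth_default; rewrite /= ltnS size_trace.
Qed.

Definition Qword (k h n : nat) (w : seq bool) : bool :=
  [&& valid k h w, all odd (peakpos false w) & sumn (peakpos false w) == n].

Lemma weight_nth_trace x h w i : (i < size (trace x h w))%N ->
  weight (nth (0, 0)%N (trace x h w) i) = (x + i)%N.
Proof.
elim: w x h i => [|b w IH] x h [|i] //=; rewrite ?addn0 // ltnS => lti.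
by rewrite IH // addnS.
Qed.

Lemma weights_peaks h w :
  [seq weight v | v <- peaks (trace 0 h w)] = peakpos false w.
Proof.
rewrite -[RHS](peaks_trace 0 h) /peaks -map_comp -[RHS]map_id.
apply/eq_in_map => i; rewrite mem_filter mem_iota => /andP[_ lti].
exact: weight_nth_trace.
Qed.

Lemma Qpaths_trace k a n w :
  (trace 0 (k - a) w \in Qpaths k a n) = Qword k (k - a) n w.
Proof.
rewrite /Qpaths; apply/idP/idP; rewrite inE /=.
all: rewrite lattice_path_trace /special_conditions traceE [head _ _]/= -traceE eqxx.
all: rewrite /Qword (valid_trace _ 0) /major_index -(weights_peaks (k - a)) all_map sumnE big_map.
all: rewrite -!andbA ?andTb => /and5P[a1 a2 a3 a4 a5]; rewrite ?a1 ?a2 ?a3 ?a4 ?a5 //.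
Qed.

Lemma lattice_path_is_trace s : lattice_path s ->
  exists w, s = trace 0 (height (head (0, 0)%N s)) w.
Proof.
by case: s => [//|v p] /and4P[/eqP v0 /path_trace[w ->] _ _]; exists w; rewrite v0; case: w.
Qed.

(** Since [lattice_path_size] bounds the length of the paths counted by [Q], the
    words of bounded length represent all of them, each exactly once. *)
Lemma Q_count k a n B : (n + k <= B)%N ->
  Q k a n = count (Qword k (k - a) n) (words B).
Proof.
move=> nkB; rewrite -size_filter -(size_map (trace 0 (k - a))).
set S := map _ _.
have uS : uniq S by rewrite map_inj_uniq ?filter_uniq ?words_uniq //; exact: trace_inj.
rewrite -[in RHS](undup_id uS) -card_fseq.
congr (#|` _|)%fset; apply/fsetP => s.
rewrite in_fset_set; last exact: finite_Qpaths.
rewrite in_fset; apply/idP/mapP => [sQ|[w + ->]]; last first.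
  by rewrite mem_filter Qpaths_trace => /andP[].
have := sQ; rewrite inE => sQ'.
have szs := lattice_path_size sQ'; case/and4P: sQ' => sl /andP[/eqP sh _] _ _.
have [w sE] := lattice_path_is_trace sl; rewrite sh in sE.
exists w => //; rewrite mem_filter mem_words -Qpaths_trace -sE sQ /=.
by move: szs; rewrite sE size_trace; lia.
Qed.

Lemma leq_size_sumn_odd s : all odd s -> (size s <= sumn s)%N.
Proof. by elim: s => //= x s IH /andP[x_odd /IH]; case: x x_odd => //; lia. Qed.

(** Peaks of odd weight have positive weight, so major index n leaves room for
    at most n of them. *)
Lemma count_Qword k h n B :
  (count (Qword k h n) (words B))%:R =
  \sum_(m < n.+1) fcoef (path_gf k m B false false h) n.
Proof.
rewrite -sum1_count big_mkcond natr_sum.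
under [RHS]eq_bigr do rewrite /path_gf big_mkcond fcoef_sum.
rewrite exchange_big; apply: eq_bigr => w _ /=.
rewrite /Qword /admissible (eq_all (a2 := odd)); last by move=> x; rewrite addbF.
set s := peakpos false w; case: (valid k h w); last by rewrite big1.
case: (boolP (all odd s)) => [odd_s|_]; last by rewrite big1.
case: (ltnP n (size s)) => szs.
  rewrite ifF /=; last by have := leq_size_sumn_odd odd_s; lia.
  by rewrite big1 // => -[m ltm] _ /=; rewrite ifF //; lia.
rewrite (bigD1 (Ordinal (szs : size s < n.+1)%N)) //= eqxx big1; last first.
  move=> [m ltm]; rewrite -val_eqE /= => ms.
  by rewrite ifF // eq_sym (negbTE ms).
by rewrite addr0 fcoefXn eq_sym; case: eqP.
Qed.

Lemma Q_path_series l a n : (0 < a <= l.+1)%N ->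
  (Q l.+1 a n)%:R = \sum_(m < n.+1) fcoef (path_series l false a m) n.
Proof.
move=> al.
have [B BP] : exists B, (n + l.+1 <= B)%N /\ forall m, (m < n.+1)%N ->
    fcoef (path_gf l.+1 m B false false (l.+1 - a)) n = fcoef (path_series l false a m) n.
  have [B BP] : exists B0, forall B, (B0 <= B)%N -> forall m, (m < n.+1)%N ->
      fcoef (path_gf l.+1 m B false false (l.+1 - a)) n = fcoef (path_series l false a m) n.
    elim: n.+1 => [|M [B0 IH]]; first by exists 0%N.
    have [B1 B1P] := path_gf_cvg l M n.+1.
    exists (maxn B0 B1) => B; rewrite geq_max => /andP[BB0 BB1] m.
    rewrite ltnS leq_eqVlt => /orP[/eqP->|]; last exact: IH.
    exact: B1P.
  exists (maxn B (n + l.+1)); split=> [|m mn]; first exact: leq_maxr.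
  by apply: BP => //; exact: leq_maxl.
case: BP => nB BP; rewrite (Q_count _ nB) count_Qword.
by apply: eq_bigr => -[m ltm] _; exact: BP.
Qed.

Lemma sum_even_from2 b (F : nat -> nat) :
  (\sum_(1 <= i < b | ~~ odd i) F i = \sum_(2 <= i < b | ~~ odd i) F i)%N.
Proof. by case: (ltnP 1 b) => b1; [rewrite big_ltn_cond | rewrite !big_geq // ltnW]. Qed.

(** * The theorem *)

Theorem theorem1p12 (k a : nat) (a_ge1 : (1 <= a)%N) (a_le_k : (a <= k)%N) :
  (odd a ->
     Fps (fun n => (Q k a n)%:R) =
     fps_sum (@partitions k) (fun N => q ^+ exponent_odd a N / denominator N))
  /\
  (~~ odd a ->
     Fps (fun n => (Q k a n)%:R) =
     fps_sum (@partitions k) (fun N => q ^+ exponent_even a N / denominator N)).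
Proof.
case: k a_le_k => [|l] a_le_k; first by lia.
have al : (0 < a <= l.+1)%N by rewrite a_ge1.
split=> a_odd; apply: fpsP => n; rewrite [LHS]/= (Q_path_series n al) /path_series.
- have -> : multisum_index false a = a.-1 by rewrite /multisum_index; lia.
  rewrite -fcoef_fps_sum; congr (fcoef (fps_sum _ _) n); apply: funext => N.
  congr (q ^+ _ / _); rewrite /exponent /exponent_odd -sum_even_from2 -subn1 -subn1 -subnDA.
  congr (_ + _ + _)%N; apply: eq_bigl => i; have -> : odd (a - 1) = false by lia.
  by rewrite eqbF_neg.
- have -> : multisum_index false a = a by rewrite /multisum_index; lia.
  rewrite -fcoef_fps_sum; congr (fcoef (fps_sum _ _) n); apply: funext => N.
  congr (q ^+ _ / _); rewrite /exponent /exponent_even -sum_even_from2 subn1.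
  congr (_ + _ + _)%N; apply: eq_bigl => i; rewrite (negbTE a_odd).
  by rewrite eqbF_neg.
Qed.
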